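(* Let $\mathcal{M}$ be a constraint hypersurface with degenerate induced form, null distribution $\mathcal{N}$ and constraint-preserving vector field $\mathcal{V}$ as described in the context, where $\mathcal{N}$ is involutive with compact embedded leaves and Hausdorff leaf space $\mathcal{M}_{\mathrm{red}}$, and $\mathcal{V}$ is projectable with respect to the null foliation. Suppose that $\mathcal{V}$ generates a continuous semiflow on $\mathcal{M}$ which is asymptotically compact and admits a bounded absorbing set, and let $\mathcal{A}\subset\mathcal{M}$ be its global attractor. Then the projected set $\mathcal{A}_\ast:=\pi(\mathcal{A})\subset\mathcal{M}_{\mathrm{red}}$ is compact and invariant under the reduced semiflow on $\mathcal{M}_{\mathrm{red}}$.
   Context: Geometric setting. $\mathcal{U}$ is a smooth $n$-dimensional manifold with a smooth symmetric $(0,2)$-tensor field $g$ of Lorentzian signature $(-,+,\dots,+)$; $\Phi:\mathcal{U}\to\mathbb{R}$ is smooth with $d\Phi\neq 0$ on $\Phi^{-1}(0)$; $\mathcal{M}=\Phi^{-1}(0)$. The restriction $g^{\mathcal{M}}=g|_{T\mathcal{M}\times T\mathcal{M}}$ has constant corank $k\ge 1$ and $\mathcal{N}=\ker g^{\mathcal{M}}\subset T\mathcal{M}$ is the null distribution. $\mathcal{V}$ is a $C^2$ vector field on $\mathcal{U}$ with $d\Phi(\mathcal{V})=0$ on $\mathcal{M}$, regarded as a vector field on $\mathcal{M}$. Foliation and quotient. When $\mathcal{N}$ is involutive, $\mathscr{F}$ is the foliation of $\mathcal{M}$ by the (connected, maximal) integral manifolds of $\mathcal{N}$ (leaves), and $\mathcal{M}_{\mathrm{red}}=\mathcal{M}/\mathscr{F}$.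 With compact embedded leaves and Hausdorff leaf space, $\mathcal{M}_{\mathrm{red}}$ carries the smooth structure for which the projection $\pi:\mathcal{M}\to\mathcal{M}_{\mathrm{red}}$ is a surjective submersion with fibers the leaves. $\mathcal{V}$ is projectable if $[\mathcal{V},W]\in\Gamma(\mathcal{N})$ for all $W\in\Gamma(\mathcal{N})$, so that there is a unique vector field $\mathcal{V}_*$ on $\mathcal{M}_{\mathrm{red}}$ with $D\pi_X(\mathcal{V}(X))=\mathcal{V}_*(\pi(X))$; the reduced semiflow is the one on $\mathcal{M}_{\mathrm{red}}$ generated by $\mathcal{V}_*$, i.e. $\pi(\varphi_t(X))$ is the image of $\pi(X)$ at time $t$. Dynamics. ''Bounded'' and $\operatorname{dist}$ refer to a fixed distance on $\mathcal{M}$ inducing its topology. The semiflow $(\varphi_t)_{t\ge0}$ is asymptotically compact if for every bounded sequence $\{X_k\}$ and every $t_k\to\infty$, $\varphi_{t_k}(X_k)$ has a convergent subsequence in $\mathcal{M}$. A bounded absorbing set is a bounded $\mathcal{B}\subset\mathcal{M}$ such that each bounded $D\subset\mathcal{M}$ has $T_D\ge0$ with $\varphi_t(D)\subset\mathcal{B}$ for $t\ge T_D$. A set is invariant if its image under the time-$t$ map equals the set for all $t\ge 0$. The global attractor $\mathcal{A}$ is the unique compact invariant subset of $\mathcal{M}$ attracting all bounded sets: $\sup_{X\in D}\operatorname{dist}(\varphi_t(X),\mathcal{A})\to0$ for every bounded $D$. *)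

(* Defs.v *)
From HB Require Import structures.
From mathcomp Require Import all_boot all_order all_algebra.
From mathcomp Require Import all_classical all_reals all_analysis.

Set Implicit Arguments.
Unset Strict Implicit.
Unset Printing Implicit Defensive.

Import Order.TTheory GRing.Theory Num.Theory.
Import numFieldNormedType.Exports.

Local Open Scope classical_set_scope.
Local Open Scope ring_scope.

Section Regularity.
Context {R : realType}.

(* Only meant for open [D]: on an open set, pointwise continuity and
   differentiability are the usual ones, and [Ck k.+1] says that [f] is
   differentiable with all directional derivatives of class C^k. *)
Fixpoint Ck (V W : normedModType R) (k : nat) (D : set V) (f : V -> W) : Prop :=
  if k is k'.+1 then
    (forall x, D x -> differentiable f x) /\
    (forall v, Ck k' D (fun x => 'D_v f x))
  else forall x, D x -> {for x, continuous f}.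

Definition smooth_on (V W : normedModType R) (D : set V) (f : V -> W) : Prop :=
  forall k, Ck k D f.

End Regularity.

Section Manifolds.
Context {R : realType}.

(* [cmap] is only relevant on [cdom], and [cinv] on the image of [cdom]; both
   take junk values elsewhere. *)
Record chart (n : nat) (T : topologicalType) := Chart {
  cdom : set T ;
  cmap : T -> 'rV[R]_n ;
  cinv : 'rV[R]_n -> T ;
  cdom_open : open cdom ;
  cimg_open : open (cmap @` cdom) ;
  cmapK : forall x, cdom x -> cinv (cmap x) = x ;
  cmap_continuous : forall x, cdom x -> {for x, continuous cmap} ;
  cinv_continuous :
    forall z, (cmap @` cdom) z -> {for z, continuous cinv} }.

Definition cimg n T (c : chart n T) : set 'rV[R]_n := cmap c @` cdom c.

(* The atlas need not be maximal. The preferred charts [chart_at] only serve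
   to give coordinates to tangent vectors, see [vector_field]. *)
Record manifold (n : nat) (T : topologicalType) := Manifold {
  atlas : set (chart n T) ;
  chart_at : T -> chart n T ;
  chart_at_atlas : forall x, atlas (chart_at x) ;
  chart_at_dom : forall x, cdom (chart_at x) x ;
  chart_compat : forall c c', atlas c -> atlas c' ->
    smooth_on (cmap c @` (cdom c `&` cdom c')) (cmap c' \o cinv c) ;
  manifold_hausdorff : hausdorff_space T ;
  manifold_countable : @second_countable T }.

Definition smooth_fun n T (mT : manifold n T) (f : T -> R) : Prop :=
  forall c, atlas mT c -> smooth_on (cimg c) (f \o cinv c : _ -> R^o).

Definition smooth_map m n S T (mS : manifold m S) (mT : manifold n T)
    (f : S -> T) : Prop :=
  continuous f /\
  forall c c', atlas mS c -> atlas mT c' ->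
    smooth_on (cmap c @` (cdom c `&` f @^-1` cdom c')) (cmap c' \o f \o cinv c).

(* The tangent space at [x] is identified with ['rV_n] by taking components in
   the chart [chart_at mT x]. Linear maps act on row vectors by multiplication
   on the right. *)
Definition vector_field n T of manifold n T := T -> 'rV[R]_n.

Definition tensor02 n T of manifold n T := T -> 'M[R]_n.

(* A field of subspaces: the fibre at [x] is the row space of the matrix. *)
Definition tangent_distribution n T of manifold n T := T -> 'M[R]_n.

Definition coord_change n T (c c' : chart n T) (x : T) : 'M[R]_n :=
  'J (cmap c' \o cinv c) (cmap c x).

Definition vf_in n T (mT : manifold n T) (V : vector_field mT)
    (c : chart n T) (z : 'rV[R]_n) : 'rV[R]_n :=
  let x := cinv c z in V x *m coord_change (chart_at mT x) c x.

Definition Ck_field n T (mT : manifold n T) (k : nat) (V : vector_field mT) :=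
  forall c, atlas mT c -> Ck k (cimg c) (vf_in V c).

Definition smooth_field n T (mT : manifold n T) (V : vector_field mT) : Prop :=
  forall k, Ck_field k V.

Definition tensor_in n T (mT : manifold n T) (g : tensor02 mT)
    (c : chart n T) (z : 'rV[R]_n) : 'M[R]_n :=
  let x := cinv c z in let P := coord_change c (chart_at mT x) x in
  P *m g x *m P^T.

Definition smooth_tensor n T (mT : manifold n T) (g : tensor02 mT) : Prop :=
  forall c, atlas mT c -> smooth_on (cimg c) (tensor_in g c).

Definition symmetric_tensor n T (mT : manifold n T) (g : tensor02 mT) : Prop :=
  forall x, (g x)^T = g x.

(* Signature (-,+,...,+): in some basis (the rows of [P]) the form is diagonal
   with one entry -1, at index [i0], and all others 1; this forces [0 < n]. *)
Definition lorentzian n T (mT : manifold n T) (g : tensor02 mT) : Prop :=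
  forall x, exists (i0 : 'I_n) (P : 'M[R]_n), P \in unitmx /\
    P *m g x *m P^T = diag_mx (\row_i (if i == i0 then -1 else 1)).

Definition dfun n T (mT : manifold n T) (f : T -> R) (x : T) (v : 'rV[R]_n) : R :=
  'd (f \o cinv (chart_at mT x) : _ -> R^o) (cmap (chart_at mT x) x) v.

Definition tmap m n S T (mS : manifold m S) (mT : manifold n T)
    (f : S -> T) (x : S) : 'M[R]_(m, n) :=
  'J (cmap (chart_at mT (f x)) \o f \o cinv (chart_at mS x))
     (cmap (chart_at mS x) x).

Definition immersion m n S T (mS : manifold m S) (mT : manifold n T)
    (f : S -> T) : Prop :=
  smooth_map mS mT f /\ forall x, row_free (tmap mS mT f x).

Definition submersion m n S T (mS : manifold m S) (mT : manifold n T)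
    (f : S -> T) : Prop :=
  smooth_map mS mT f /\ forall x, row_full (tmap mS mT f x).

Definition topological_embedding (S T : topologicalType) (f : S -> T) : Prop :=
  [/\ injective f, continuous f &
      forall A, open A -> exists2 B, open B & A = f @^-1` B].

Definition pullback m n S T (mS : manifold m S) (mT : manifold n T)
    (f : S -> T) (g : tensor02 mT) : tensor02 mS :=
  fun x => tmap mS mT f x *m g (f x) *m (tmap mS mT f x)^T.

(* The fibre at [x] consists of the [v] with [g(df v, df w) = 0] for all [w]. *)
Definition null_distribution m n S T (mS : manifold m S) (mT : manifold n T)
    (f : S -> T) (g : tensor02 mT) : tangent_distribution mS :=
  fun x => kermx (pullback mS f g x).

(* [X x] is mapped to [Y (f x)] by the differential of [f] at [x]. *)
Definition related m n S T (mS : manifold m S) (mT : manifold n T)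
    (f : S -> T) (X : vector_field mS) (Y : vector_field mT) : Prop :=
  forall x, X x *m tmap mS mT f x = Y (f x).

(* [X,Y] = DY(X) - DX(Y), computed in the chart [chart_at mT x]. *)
Definition bracket n T (mT : manifold n T) (X Y : vector_field mT) :
    vector_field mT :=
  fun x => let c := chart_at mT x in
    X x *m 'J (vf_in Y c) (cmap c x) - Y x *m 'J (vf_in X c) (cmap c x).

End Manifolds.

Section Foliations.
Context {R : realType} {n : nat} {T : topologicalType}.
Variable (mT : @manifold R n T).

Variable (D : tangent_distribution mT).

Definition takes_values_in (W : vector_field mT) : Prop :=
  forall x, (W x <= D x)%MS.

Definition smooth_section (W : vector_field mT) : Prop :=
  smooth_field W /\ takes_values_in W.

Definition involutive_distribution : Prop := forall X Y : vector_field mT,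
  smooth_section X -> smooth_section Y -> takes_values_in (bracket X Y).

Definition projectable (V : vector_field mT) : Prop :=
  forall W, smooth_section W -> takes_values_in (bracket V W).

(* [j] presents [L] as a (nonempty, injectively immersed) connected integral
   manifold; the dimension [k] of [S] is then the rank of [D] along [L]. *)
Definition integral_immersion (k : nat) (S : topologicalType)
    (mS : @manifold R k S) (j : S -> T) (L : set T) : Prop :=
  [/\ [set: S] !=set0 /\ connected [set: S],
      injective j,
      immersion mS mT j,
      forall s, (tmap mS mT j s :=: D (j s))%MS &
      range j = L].

Definition connected_integral_manifold (L : set T) : Prop :=
  exists k S (mS : @manifold R k S) j, integral_immersion mS j L.

Definition leaf (L : set T) : Prop :=
  connected_integral_manifold L /\
  forall L', connected_integral_manifold L' -> L `<=` L' -> L' = L.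

Definition compact_embedded (L : set T) : Prop :=
  exists k S (mS : @manifold R k S) j,
    [/\ integral_immersion mS j L, compact [set: S] & topological_embedding j].

(* [p : T -> Q] is a quotient map onto the leaf space, whose smooth structure
   makes it a submersion; [Q] is Hausdorff because it is a [manifold]. *)
Definition is_leaf_space (q : nat) (Q : topologicalType)
    (mQ : @manifold R q Q) (p : T -> Q) : Prop :=
  [/\ forall y, exists x, p x = y,
      [set p @^-1` [set y] | y in [set: Q]] = leaf,
      forall A : set Q, open A <-> open (p @^-1` A) &
      submersion mT mQ p].

End Foliations.

Section Semiflows.
Context {R : realType}.

(* Semiflows are families [phi t] for [0 <= t]; the values for [t < 0] are
   irrelevant. *)
Definition continuous_semiflow (T : topologicalType) (phi : R -> T -> T) :=
  [/\ forall x, phi 0 x = x,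
      forall s t x, 0 <= s -> 0 <= t -> phi (s + t) x = phi s (phi t x) &
      {within [set u : R * T | 0 <= u.1],
        continuous (fun u : R * T => phi u.1 u.2)}].

(* The derivative is one-sided at time 0. *)
Definition integral_curve n T (mT : @manifold R n T) (V : vector_field mT)
    (gamma : R -> T) : Prop :=
  {within [set t : R | 0 <= t], continuous gamma} /\
  forall t : R, 0 <= t -> let c := chart_at mT (gamma t) in
    (s - t)^-1 *: (cmap c (gamma s) - cmap c (gamma t))
      @[s --> within [set s | 0 <= s] (t^')] --> V (gamma t).

Definition generates n T (mT : @manifold R n T) (V : vector_field mT)
    (phi : R -> T -> T) : Prop :=
  continuous_semiflow phi /\ forall x, integral_curve V (phi^~ x).

Definition invariant_set T (phi : R -> T -> T) (A : set T) : Prop :=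
  forall t, 0 <= t -> phi t @` A = A.

Variables (M : metricType R).

Definition mbounded (D : set M) : Prop :=
  exists C : R, forall x y, D x -> D y -> mdist x y <= C.

(* Distance to a set, equal to +oo for the empty set. *)
Definition set_dist (x : M) (A : set M) : \bar R :=
  ereal_inf [set (mdist x a)%:E | a in A].

Definition asymptotically_compact (phi : R -> M -> M) : Prop :=
  forall (X : nat -> M) (t : nat -> R), mbounded (range X) ->
    (forall i, 0 <= t i) -> t @ \oo --> +oo ->
    exists2 s : nat -> nat, {homo s : i j / (i < j)%N} &
      exists l : M, phi (t (s i)) (X (s i)) @[i --> \oo] --> l.

Definition bounded_absorbing (phi : R -> M -> M) (B : set M) : Prop :=
  mbounded B /\
  forall D, mbounded D -> exists2 T : R, 0 <= T &
    forall t, T <= t -> phi t @` D `<=` B.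

(* The supremum over the empty set is -oo in [\bar R], whence the restriction
   to nonempty [D]. *)
Definition attracts_bounded (phi : R -> M -> M) (A : set M) : Prop :=
  forall D, mbounded D -> D !=set0 ->
    ereal_sup [set set_dist (phi t x) A | x in D] @[t --> +oo] --> 0%E.

Definition global_attractor (phi : R -> M -> M) (A : set M) : Prop :=
  [/\ compact A, invariant_set phi A & attracts_bounded phi A].

End Semiflows.

(* Main.v *)
Require Import Defs.
From HB Require Import structures.
From mathcomp Require Import all_boot all_order all_algebra.
From mathcomp Require Import all_classical all_reals all_analysis.
From mathcomp Require Import ring lra.
Import Order.TTheory GRing.Theory Num.Theory.
Import numFieldNormedType.Exports.
Local Open Scope classical_set_scope.
Local Open Scope ring_scope.

(** The projection [p] maps trajectories of [VM] to integral curves of [VQ], so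
    everything reduces to uniqueness of integral curves of [VQ], which gives
    [p (phi t x) = psi t (p x)]; the two claims then follow from the compactness
    and invariance of [A]. Uniqueness holds because [VQ] is locally Lipschitz:
    [VM] inherits this from the C^2 field [V] through the immersion [iota], and
    since in charts [VQ \o p] is [VM] times the Jacobian of [p], it passes to [VQ]
    by composing with a local Lipschitz section of the submersion [p]. *)

Set Implicit Arguments.
Unset Strict Implicit.
Unset Printing Implicit Defensive.

(** * Jacobians and strict differentiability *)

Section MatrixNorm.
Context {R : realType}.

Lemma ler_norm_entry m n (A : 'M[R]_(m, n)) i j : `|A i j| <= `|A|.
Proof.
rewrite [leRHS]/Num.Def.normr/= mx_normrE.
exact: (le_bigmax _ (fun ij : 'I_m * 'I_n => `|A ij.1 ij.2|) (i, j)).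
Qed.

Lemma mx_norm_ler m n (A : 'M[R]_(m, n)) (c : R) : 0 <= c ->
  (forall i j, `|A i j| <= c) -> `|A| <= c.
Proof.
move=> c0 Ac; rewrite [leLHS]/Num.Def.normr/= mx_normrE.
by apply: bigmax_le => // -[i j] _; exact: Ac.
Qed.

(** The norm is the largest absolute value of an entry, not an operator norm; summing [n] products
    costs the factor [n]. *)
Lemma ler_normM m n q (A : 'M[R]_(m, n)) (B : 'M[R]_(n, q)) :
  `|A *m B| <= n%:R * `|A| * `|B|.
Proof.
apply: mx_norm_ler => [|i j]; first by rewrite !mulr_ge0.
rewrite mxE (le_trans (ler_norm_sum _ _ _))// -mulrA mulr_natl.
have -> : (`|A| * `|B|) *+ n = \sum_(l < n) (`|A| * `|B|).
  by rewrite sumr_const card_ord.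
rewrite ler_sum// => l _.
by rewrite normrM ler_pM// ler_norm_entry.
Qed.

End MatrixNorm.

(** * Jacobians: chain rule, locality and the mean value theorem *)

Section Jacobian.
Context {R : realType}.

Lemma diff_jacobian m n (f : 'rV[R]_m -> 'rV[R]_n) a v :
  'd f a v = v *m 'J f a.
Proof. by rewrite /jacobian mul_rV_lin1. Qed.

Lemma jacobian_comp m n q (f : 'rV[R]_m -> 'rV[R]_n) (g : 'rV[R]_n -> 'rV[R]_q) a :
  differentiable f a -> differentiable g (f a) ->
  'J (g \o f) a = 'J f a *m 'J g (f a).
Proof.
move=> df dg; apply/row_matrixP => i.
by rewrite !rowE mulmxA -!diff_jacobian diff_comp.
Qed.

(** The difference [g - f] vanishes near [a], hence has differential zero there, and [g] is [f] plus
    this difference. *)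
Lemma near_eq_differentiable (V W : normedModType R) (f g : V -> W) a :
  (\near a, f a = g a) -> differentiable f a -> differentiable g a.
Proof.
move=> fg df; pose k := g - f.
have k0 : \forall h \near 0, k (h + a) = 0.
  suff : \forall z \near a, k z = 0 by rewrite (near_shift 0 a)/= subr0.
  by apply: filterS fg => z; rewrite /k !fctE => ->; rewrite subrr.
have kE : k \o shift a = cst (k a) + \0 +o_ 0 id.
  apply/eqaddoP => e e0; apply: filterS k0 => h kh.
  have ka : k a = 0 by rewrite /k !fctE -(nbhs_singleton fg) subrr.
  change (`|k (h + a) - (k a + 0)| <= e * `|h|).
  rewrite kh ka addr0 subrr normr0.
  by rewrite mulr_ge0// ltW.
have dk0 : 'd k a = \0 :> (V -> W).
  exact: (@diff_unique _ _ _ k \0 a (@cst_continuous _ _ 0) kE).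
have dk : differentiable k a.
  by apply/diff_locallyP; rewrite dk0; split=> //; exact: cst_continuous.
have -> : g = f + k by apply/funext => x; rewrite /k/= !fctE addrC subrK.
exact: differentiableD.
Qed.

Lemma row_jacobian m n (f : 'rV[R]_m -> 'rV[R]_n) a i : differentiable f a ->
  row i ('J f a) = 'D_(delta_mx 0 i) f a.
Proof. by move=> df; rewrite rowE deriveEjacobian. Qed.

Lemma near_eq_jacobian m n (f g : 'rV[R]_m -> 'rV[R]_n) a :
  (\near a, f a = g a) -> differentiable f a -> 'J f a = 'J g a.
Proof.
move=> fg df; have dg := near_eq_differentiable fg df.
apply/row_matrixP => i.
apply: etrans (row_jacobian i df) _; apply: etrans (esym (row_jacobian i dg)).
exact: near_eq_derive.
Qed.

Lemma is_derive_segment m n (f : 'rV[R]_m -> 'rV[R]_n) a v t j :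
  differentiable f (a + t *: v) ->
  is_derive t (1 : R) (fun s => f (a + s *: v) 0 j : R)
    ((v *m 'J f (a + t *: v)) 0 j).
Proof.
move=> df.
pose l (s : R) : 'rV[R]_m := a + s *: v.
have dl : differentiable l t.
  by apply: differentiableD => //; apply: differentiableZl.
have dfl : differentiable (f \o l) t by exact: differentiable_comp.
pose pr (N : 'rV[R]_n) : R := N 0 j.
have dp : differentiable pr (f (l t)) by exact: differentiable_coord.
have dh : differentiable (pr \o (f \o l)) t by exact: differentiable_comp.
split; first by apply/derivable1_diffP.
rewrite (deriveE _ dh) (diff_comp dfl dp) /= (diff_comp dl df) /=.
(* For [h] different from 0 the difference quotient of the affine map [l] is constantly [v]. The
   linear map [pr] is treated in the same way below. *)
have -> : 'd l t 1 = v.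
  rewrite -(deriveE _ dl) /derive; apply: cvg_lim => //.
  apply: cvg_near_cst; near=> h; rewrite /l/= [_%:A]mulr1 scalerDl.
  rewrite addrCA addrK scalerA mulVf ?scale1r//.
  near: h; exact: nbhs_dnbhs_neq.
rewrite diff_jacobian.
rewrite -(deriveE _ dp) /derive; apply: cvg_lim => //.
apply: cvg_near_cst; near=> h; rewrite /pr/= !mxE addrK.
rewrite [_ *: _]mulrA mulVf ?mul1r//.
near: h; exact: nbhs_dnbhs_neq.
Unshelve. all: by end_near. Qed.

(** The scalar mean value theorem, applied to one coordinate along the segment; the intermediate
    parameter [t] depends on [j]. *)
Lemma jacobian_MVT m n (f : 'rV[R]_m -> 'rV[R]_n) a v j :
  (forall t : R, 0 <= t <= 1 -> differentiable f (a + t *: v)) ->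
  exists2 t : R, 0 <= t <= 1 &
    (f (a + v) - f a) 0 j = (v *m 'J f (a + t *: v)) 0 j.
Proof.
move=> df; pose h t := f (a + t *: v) 0 j.
have dh (t : R) : 0 <= t <= 1 ->
    is_derive t (1 : R) h ((v *m 'J f (a + t *: v)) 0 j).
  by move=> t01; apply/is_derive_segment/df.
have [t||t t01] :=
  @MVT_segment R h (fun t => (v *m 'J f (a + t *: v)) 0 j) 0 1 ler01.
- by rewrite in_itv/= => /andP[t0 t1]; apply: dh; rewrite !ltW.
- apply: derivable_within_continuous => s; rewrite in_itv/= => s01.
  exact: (@ex_derive _ _ _ _ _ _ _ (dh s s01)).
- rewrite /h scale1r scale0r addr0 subr0 mulr1 => hE.
  by exists t; [rewrite in_itv in t01|rewrite -hE !mxE].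
Qed.

End Jacobian.

(** * Strict differentiability and Lipschitz bounds for C^1 and C^2 maps *)

Section StrictDifferentiability.
Context {R : realType}.

Lemma ball_segment (V : normedModType R) (x y z : V) (r t : R) :
  ball x r y -> ball x r z -> 0 <= t <= 1 -> ball x r (y + t *: (z - y)).
Proof.
rewrite -!ball_normE/= => xy xz /andP[t0 t1].
have -> : x - (y + t *: (z - y)) = (1 - t) *: (x - y) + t *: (x - z).
  rewrite scalerBl scale1r -addrA -scalerN -scalerDr opprB subrKA.
  by rewrite opprD addrA -scalerN opprB.
rewrite (le_lt_trans (ler_normD _ _))// !normrZ ger0_norm ?subr_ge0//.
rewrite ger0_norm//.
(* Strictness is taken from the term with weight [t], so [t = 0] is treated apart. *)
have [->|tn0] := eqVneq t 0; first by rewrite subr0 mul1r mul0r addr0.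
rewrite [ltRHS](_ : r = (1 - t) * r + t * r); last first.
  by rewrite -mulrDl subrK mul1r.
apply: ler_ltD; first by apply: ler_wpM2l; [rewrite subr_ge0|exact: ltW].
by rewrite ltr_pM2l// lt_neqAle eq_sym tn0.
Qed.

Lemma C1_jacobian_continuous m n (D : set 'rV[R]_m) (f : 'rV[R]_m -> 'rV[R]_n)
    z0 : open D -> D z0 -> Ck 1 D f ->
  forall e : R, 0 < e -> \forall z \near z0, `|'J f z - 'J f z0| <= e.
Proof.
move=> oD Dz0 [df cf] e e0.
have Df (i : 'I_m) : \forall z \near z0,
    `|'D_(delta_mx 0 i) f z0 - 'D_(delta_mx 0 i) f z| <= e.
  by have /cvgrPdist_le/(_ e e0) := cf (delta_mx 0 i) z0 Dz0.
have DD : \forall z \near z0, D z by exact: open_nbhs_nbhs.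
apply: filterS2 DD (filter_forall _ Df) => z Dz Hz.
apply: mx_norm_ler (ltW e0) _ => i j.
apply: (le_trans _ (Hz i)); rewrite distrC.
have -> : ('J f z - 'J f z0) i j = row i ('J f z - 'J f z0) 0 j by rewrite !mxE.
apply: le_trans (ler_norm_entry _ _ _) _; rewrite linearB/=.
have Ez := row_jacobian i (df _ Dz); have Ez0 := row_jacobian i (df _ Dz0).
by rewrite [X in `|X - _|]Ez [X in `|_ - X|]Ez0.
Qed.

(** By the mean value theorem each coordinate of the error is that of [z - z'] times a difference of
    Jacobians, which is small near [z0] by continuity. *)
Lemma C1_strict m n (D : set 'rV[R]_m) (f : 'rV[R]_m -> 'rV[R]_n) z0 :
  open D -> D z0 -> Ck 1 D f -> forall e : R, 0 < e ->
  exists2 N, nbhs z0 N & forall z z', N z -> N z' ->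
    `|f z - f z' - (z - z') *m 'J f z0| <= e * `|z - z'|.
Proof.
move=> oD Dz0 Cf e e0.
(* The denominator absorbs the factor [m] of [ler_normM]; the successor keeps it nonzero when
   [m = 0]. *)
have e'0 : 0 < e / m.+1%:R by rewrite divr_gt0.
have Jc := C1_jacobian_continuous oD Dz0 Cf e'0.
have /nbhs_ballP[r r0 rD] : \forall z \near z0,
    D z /\ `|'J f z - 'J f z0| <= e / m.+1%:R.
  by apply: filterI => //; exact: open_nbhs_nbhs.
exists (ball z0 r); first exact: nbhsx_ballx.
move=> z z' zr z'r; apply: mx_norm_ler => [|i j]; first by rewrite mulr_ge0// ltW.
rewrite (ord1 i) {i}.
have seg (t : R) : 0 <= t <= 1 -> ball z0 r (z' + t *: (z - z')).
  exact: ball_segment.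
have [t t01|t t01] := @jacobian_MVT R m n f z' (z - z') j.
  by have [+ _] := rD _ (seg t t01); apply: Cf.1.
rewrite [z' + (z - z')]addrC subrK => fE.
have {seg} [_ Jt] := rD _ (seg t t01).
have -> : (f z - f z' - (z - z') *m 'J f z0) 0 j =
    ((z - z') *m ('J f (z' + t *: (z - z')) - 'J f z0)) 0 j.
  by rewrite mulmxBr mxE fE [RHS]mxE.
rewrite (le_trans (ler_norm_entry _ _ _))// (le_trans (ler_normM _ _))//.
rewrite mulrAC ler_wpM2r// (le_trans (ler_wpM2l _ Jt))//.
rewrite mulrCA; apply: ler_piMr; first exact: ltW.
by rewrite ler_pdivrMr// mul1r ler_nat.
Qed.

Definition lipschitz_near (V W : normedModType R) (f : V -> W) (z0 : V) :=
  exists2 L : R, 0 < L & exists2 N, nbhs z0 N &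
    forall z z', N z -> N z' -> `|f z - f z'| <= L * `|z - z'|.

Lemma C1_lipschitz_near m n (D : set 'rV[R]_m) (f : 'rV[R]_m -> 'rV[R]_n) z0 :
  open D -> D z0 -> Ck 1 D f -> lipschitz_near f z0.
Proof.
move=> oD Dz0 Cf; exists (1 + (m%:R * `|'J f z0|)); first by rewrite ltr_wpDr// mulr_ge0.
have [N Nz0 Nf] := C1_strict oD Dz0 Cf ltr01.
exists N => // z z' Nz Nz'; rewrite -[f z - f z'](subrK ((z - z') *m 'J f z0)).
rewrite (le_trans (ler_normD _ _))// mulrDl lerD ?Nf//.
by rewrite (le_trans (ler_normM _ _))// mulrAC.
Qed.

(** The rows of the Jacobian are directional derivatives of class C^1, hence locally Lipschitz; the
    sum of their constants dominates each of them. *)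
Lemma C2_lipschitz_near_jacobian m n (D : set 'rV[R]_m)
    (f : 'rV[R]_m -> 'rV[R]_n) z0 :
  open D -> D z0 -> Ck 2 D f -> lipschitz_near (fun z => 'J f z) z0.
Proof.
move=> oD Dz0 [df Cf].
have /choice[L LP] i : exists L : R, 0 < L /\ exists N, nbhs z0 N /\
    forall z z', N z -> N z' ->
    `|'D_(delta_mx 0 i) f z - 'D_(delta_mx 0 i) f z'| <= L * `|z - z'|.
  have [L L0 [N Nz0 NP]] := C1_lipschitz_near oD Dz0 (Cf (delta_mx 0 i)).
  by exists L; split=> //; exists N.
exists (1 + \sum_i L i).
  by rewrite ltr_wpDr// sumr_ge0// => i _; rewrite ltW// (LP i).1.
have /choice[N NP] i := (LP i).2.
exists [set z | D z /\ forall i, N i z].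
  apply: filterI; first exact: open_nbhs_nbhs.
  by apply: (@filter_forall _ _ N (nbhs z0)) => i; exact: (NP i).1.
move=> z z' [Dz Nz] [Dz' Nz'].
have L_ge0 i : 0 <= L i by rewrite ltW// (LP i).1.
apply: mx_norm_ler => [|i j]; first by rewrite mulr_ge0// addr_ge0// sumr_ge0//.
have -> : ('J f z - 'J f z') i j = row i ('J f z - 'J f z') 0 j by rewrite !mxE.
rewrite linearB/=.
have Ez := row_jacobian i (df _ Dz); have Ez' := row_jacobian i (df _ Dz').
rewrite (le_trans (ler_norm_entry _ _ _))//.
rewrite [X in `|X - _|]Ez [X in `|_ - X|]Ez' (le_trans ((NP i).2 _ _ _ _))//.
rewrite ler_wpM2r// (bigD1 i)//= addrCA lerDl addr_ge0// sumr_ge0//.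
Qed.

End StrictDifferentiability.

(** * Locally Lipschitz maps *)

Section LipschitzNear.
Context {R : realType}.

Lemma near_lipschitz_eq (V W : normedModType R) (f g : V -> W) z0 :
  (\near z0, f z0 = g z0) -> lipschitz_near f z0 -> lipschitz_near g z0.
Proof.
move=> fg [L L0 [N Nz0 NP]]; exists L => //.
exists (N `&` [set z | f z = g z]); first exact: filterI.
by move=> z z' [Nz <-] [Nz' <-]; exact: NP.
Qed.

Lemma lipschitz_near_cst (V W : normedModType R) (w : W) (z0 : V) :
  lipschitz_near (fun=> w) z0.
Proof.
exists 1 => //; exists setT; first exact: filterT.
by move=> z z' _ _; rewrite subrr normr0 mulr_ge0.
Qed.

Lemma lipschitz_near_continuous (V W : normedModType R) (f : V -> W) z0 :
  lipschitz_near f z0 -> {for z0, continuous f}.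
Proof.
move=> [L L0 [N Nz0 NP]]; apply/cvgrPdist_le => e e0.
have : \forall z \near z0, `|z0 - z| <= e / L.
  by apply: cvgr_dist_le => //; rewrite divr_gt0.
move=> zL; apply: filterS2 (Nz0) zL => z Nz zL.
apply: le_trans (NP _ _ (nbhs_singleton Nz0) Nz) _.
by rewrite mulrC -ler_pdivlMr.
Qed.

Lemma lipschitz_near_bounded (V W : normedModType R) (f : V -> W) z0 :
  lipschitz_near f z0 -> \forall z \near z0, `|f z| <= `|f z0| + 1.
Proof.
move=> /lipschitz_near_continuous/cvgrPdist_le/(_ 1 ltr01).
apply: filterS => z fz; rewrite -[f z](subKr (f z0)).
by rewrite (le_trans (ler_normB _ _))// lerD2l.
Qed.

Lemma lipschitz_near_comp (V W X : normedModType R) (f : V -> W) (g : W -> X) z0 :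
  lipschitz_near f z0 -> lipschitz_near g (f z0) -> lipschitz_near (g \o f) z0.
Proof.
move=> fl [K K0 [M Mz0 MP]].
have fc : \forall z \near z0, M (f z) by exact: lipschitz_near_continuous fl _ Mz0.
have [L L0 [N Nz0 NP]] := fl.
exists (K * L); first exact: mulr_gt0.
exists (N `&` [set z | M (f z)]); first exact: filterI.
move=> z z' [Nz Mz] [Nz' Mz'] /=; rewrite (le_trans (MP _ _ _ _))//.
by rewrite -mulrA ler_pM2l// NP.
Qed.

Lemma lipschitz_near_mulmx (V : normedModType R) m n q
    (f : V -> 'M[R]_(m, n)) (g : V -> 'M[R]_(n, q)) z0 :
  lipschitz_near f z0 -> lipschitz_near g z0 ->
  lipschitz_near (fun z => f z *m g z) z0.
Proof.
move=> fl gl.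
have fb := lipschitz_near_bounded fl; have gb := lipschitz_near_bounded gl.
have [L L0 [N Nz0 NP]] := fl; have [K K0 [M Mz0 MP]] := gl.
(* Near [z0] the norms of [f] and [g] exceed their values at [z0] by at most 1; the last [1] keeps
   the constant positive when [n = 0]. *)
exists (n%:R * (L * (`|g z0| + 1) + (`|f z0| + 1) * K) + 1).
  by rewrite ltr_wpDl// mulr_ge0// addr_ge0// mulr_ge0// ?addr_ge0// ltW.
exists (N `&` M `&` ([set z | `|f z| <= `|f z0| + 1] `&`
    [set z | `|g z| <= `|g z0| + 1])).
  by apply: filterI; exact: filterI.
move=> z z' [[Nz Mz] [fz gz]] [[Nz' Mz'] [fz' gz']].
have -> : f z *m g z - f z' *m g z' =
    (f z - f z') *m g z + f z' *m (g z - g z').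
  by rewrite mulmxBl mulmxBr addrA subrK.
set d := `|z - z'|.
have fgz : `|f z - f z'| * `|g z| <= (L * d) * (`|g z0| + 1).
  by rewrite ler_pM// NP.
have gfz : `|f z'| * `|g z - g z'| <= (`|f z0| + 1) * (K * d).
  by rewrite ler_pM// MP.
rewrite (le_trans (ler_normD _ _))// mulrDl mul1r ler_wpDr ?normr_ge0//.
rewrite -mulrA mulrDl mulrDr lerD// (le_trans (ler_normM _ _))// -mulrA ler_wpM2l//.
  by rewrite mulrAC.
by rewrite -mulrA.
Qed.

(* Near [z0] the matrix [B z] times a right inverse [S] of [B z0] is close to
   the identity, so that [X z] is controlled by [X z *m B z *m S]. *)
Lemma lipschitz_near_solve (V : normedModType R) m n
    (X : V -> 'rV[R]_m) (B : V -> 'M[R]_(m, n)) (Y : V -> 'rV[R]_n) z0 :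
  lipschitz_near B z0 -> lipschitz_near Y z0 -> row_free (B z0) ->
  (\forall z \near z0, X z *m B z = Y z) -> lipschitz_near X z0.
Proof.
move=> Bl Yl Bfree XBY; pose S := pinvmx (B z0).
pose N z := B z *m S.
have Nl : lipschitz_near N z0.
  exact: (lipschitz_near_mulmx Bl (lipschitz_near_cst S z0)).
have YSl : lipschitz_near (fun z => Y z *m S) z0.
  exact: (lipschitz_near_mulmx Yl (lipschitz_near_cst S z0)).
have Nz0 : N z0 = 1%:M by exact: mulmxVp.
(* Once [N z] is close enough to the identity, [v - v *m N z] has at most half the norm of [v],
   whence the factor 2. *)
have N1 : \forall z \near z0, forall v : 'rV[R]_m, `|v| <= 2 * `|v *m N z|.
  have e0 : 0 < (2 * m.+1%:R)^-1 :> R by rewrite invr_gt0 mulr_gt0.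
  have /cvgrPdist_le/(_ _ e0) Nc := lipschitz_near_continuous Nl.
  apply: filterS (Nc) => z; rewrite Nz0 => Nz v.
  have : `|v *m (1%:M - N z)| <= 2^-1 * `|v|.
    rewrite (le_trans (ler_normM _ _))// mulrAC ler_wpM2r//.
    rewrite (le_trans (ler_wpM2l _ Nz))// invfM mulrCA ler_piMr ?invr_ge0//.
    by rewrite ler_pdivrMr// mul1r ler_nat.
  rewrite mulmxBr mulmx1 => vN.
  have := ler_normD (v - v *m N z) (v *m N z); rewrite subrK.
  lra.
have XS : \forall z \near z0, X z *m N z = Y z *m S.
  by apply: filterS XBY => z <-; rewrite mulmxA.
have Yb := lipschitz_near_bounded YSl.
have [L L0 [U Uz0 UP]] := Nl; have [K K0 [U' U'z0 U'P]] := YSl.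
(* [C] will bound [X] near [z0], through [X z *m N z = Y z *m S]. *)
have [C C0 CE] : exists2 C, 0 < C & C = 2 * (`|Y z0 *m S| + 1).
  by eexists; [|by []]; rewrite mulr_gt0// ltr_wpDl.
exists (2 * (K + m%:R * C * L)).
  by rewrite mulr_gt0// ltr_wpDr// !mulr_ge0// ltW.
exists [set z | [/\ U z, U' z, (forall v : 'rV[R]_m, `|v| <= 2 * `|v *m N z|),
    X z *m N z = Y z *m S & `|Y z *m S| <= `|Y z0 *m S| + 1]].
  near=> z; split; near: z => //.
move=> z z' [Uz U'z Nz XSz Yz] [Uz' U'z' Nz' XSz' Yz'].
have Xz' : `|X z'| <= C.
  by rewrite (le_trans (Nz' _))// XSz' CE ler_wpM2l.
rewrite (le_trans (Nz _))// -mulrA ler_wpM2l//.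
have -> : (X z - X z') *m N z =
    (Y z *m S - Y z' *m S) - X z' *m (N z - N z').
  by rewrite mulmxBl mulmxBr XSz XSz' opprB addrA subrK.
rewrite (le_trans (ler_normB _ _))// mulrDl lerD ?U'P//.
rewrite (le_trans (ler_normM _ _))// -!mulrA ler_wpM2l//.
by apply: ler_pM => //; exact: UP.
Unshelve. all: by end_near. Qed.

End LipschitzNear.

(** * Local Lipschitz sections of submersions and descent of vector fields *)

Section LipschitzSection.
Context {R : realType}.

(** Solutions of [G v = y] are the fixed points of [v - (G v - y)]. This map contracts by 1/2 and
    preserves the closed ball of radius [r], each of [y - G 0] and [G v - G 0 - v] having norm at
    most [r / 2]. *)
Lemma near_id_surjective n (G : 'rV[R]_n -> 'rV[R]_n) (r : R) : 0 < r ->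
  (forall v v', `|v| <= r -> `|v'| <= r ->
     `|G v - G v' - (v - v')| <= 2^-1 * `|v - v'|) ->
  forall y, `|y - G 0| <= r / 2 -> exists2 v, `|v| <= r & G v = y.
Proof.
move=> r0 GP y yG.
pose B : set 'rV[R]_n := [set v | `|v| <= r].
pose F v := v - (G v - y).
have FB : set_fun B B F.
  move=> v Bv; rewrite /B/=.
  have := GP v 0 Bv; rewrite normr0 => /(_ (ltW r0)); rewrite subr0 => Gv.
  have -> : F v = (y - G 0) - (G v - G 0 - v).
    by apply/rowP => i; rewrite !mxE; ring.
  have := ler_normB (y - G 0) (G v - G 0 - v).
  have : `|v| <= r by [].
  lra.
have h0 : (0 : R) <= 2^-1 by rewrite invr_ge0.
have ctr : is_contraction (mkfun FB).
  exists (NngNum h0); split; first by rewrite /=; lra.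
  move=> [v v'] [Bv Bv'] /=.
  rewrite -normrN; have -> : - (mkfun FB v - mkfun FB v') = G v - G v' - (v - v').
    by rewrite /mkfun /F; apply/rowP => i; rewrite !mxE; ring.
  exact: GP.
have cB : closed B.
  rewrite (_ : B = closed_ball_ Num.norm 0 r); first exact: closed_closed_ball_.
  by apply/seteqP; split=> v; rewrite /B/closed_ball_/= add0r normrN.
(* Matrices have a complete and a normed structure, but no declared join of the two. *)
pose X := HB.pack_for (completeNormedModType R) 'rV[R]_n.
have [|v Bv vF] := @banach_fixed_point R X B (mkfun FB) ctr cB.
  by exists 0; rewrite /B/= normr0 ltW.
exists v => //; have vE : v = v - (G v - y) by exact: vF.
by have /eqP := congr1 (fun w => v - w) vE; rewrite subrr subKr eq_sym subr_eq0 => /eqP.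
Qed.

(* With [S] a right inverse of ['J P z0], the map [v |-> P (z0 + v *m S)] is
   close to a translation near 0, so that it can be inverted there. *)
Lemma lipschitz_section m n (D : set 'rV[R]_m) (P : 'rV[R]_m -> 'rV[R]_n) z0 :
  open D -> D z0 -> Ck 1 D P -> row_full ('J P z0) ->
  exists s : 'rV[R]_n -> 'rV[R]_m,
    [/\ s (P z0) = z0, lipschitz_near s (P z0) & \forall y \near P z0, P (s y) = y].
Proof.
move=> oD Dz0 CP Pfull; pose S := pinvmx ('J P z0).
have SJ : S *m 'J P z0 = 1%:M by exact: mulVpmx.
pose K := n%:R * `|S| + 1.
have K0 : 0 < K by rewrite ltr_wpDl// mulr_ge0.
have SK (v : 'rV[R]_n) : `|v *m S| <= K * `|v|.
  rewrite (le_trans (ler_normM _ _))// /K mulrDl mul1r mulrAC.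
  by rewrite lerDl.
(* Since [S] expands norms by at most [K], an error ratio [(2 * K)^-1] for [P] becomes 1/2 for
   [G]. *)
have e0 : 0 < (2 * K)^-1 by rewrite invr_gt0 mulr_gt0.
have [N Nz0 NP] := C1_strict oD Dz0 CP e0.
have /nbhs_ballP[r /= r0 rN] := Nz0.
(* For [v] of norm at most [d], the displacement [v *m S] has norm at most [r / 2]. *)
pose d := r / (2 * K).
have d0 : 0 < d by rewrite divr_gt0// mulr_gt0.
have dN (v : 'rV[R]_n) : `|v| <= d -> N (z0 + v *m S).
  move=> vd; apply: rN; rewrite -ball_normE/= opprD addrA subrr add0r normrN.
  rewrite (le_lt_trans (SK _))// (le_lt_trans (ler_wpM2l (ltW K0) vd))//.
  by rewrite [K * d](_ : _ = r / 2); [lra|rewrite /d; field; exact: lt0r_neq0].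
pose G v := P (z0 + v *m S).
have GP v v' : `|v| <= d -> `|v'| <= d ->
     `|G v - G v' - (v - v')| <= 2^-1 * `|v - v'|.
  move=> vd v'd; have := NP _ _ (dN _ vd) (dN _ v'd).
  rewrite opprD addrACA subrr add0r -mulmxBl -mulmxA SJ mulmx1 => /le_trans; apply.
  rewrite invfM -mulrA ler_wpM2l ?invr_ge0// ler_pdivrMl//.
have G0 : G 0 = P z0 by rewrite /G mul0mx addr0.
have GS := near_id_surjective d0 GP.
(* Outside the ball of radius [d / 2] about [P z0] the chosen value is the default 0. *)
have /choice[s sP] y : exists v, `|y - P z0| <= d / 2 -> `|v| <= d /\ G v = y.
  have [yP|yP] := leP `|y - P z0| (d / 2); last by exists 0.
  by have [|v] := GS y; [rewrite G0|exists v].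
exists (fun y => z0 + s y *m S).
(* [G] shrinks distances by at most a factor 2. Hence [s] is Lipschitz, and it takes the value 0 at
   [P z0] by injectivity. *)
have GL v v' : `|v| <= d -> `|v'| <= d -> `|v - v'| <= 2 * `|G v - G v'|.
  move=> vd v'd; have := GP v v' vd v'd; have := ler_normB (G v - G v') (G v - G v' - (v - v')).
  rewrite subKr; lra.
have nP : \forall y \near P z0, `|y - P z0| <= d / 2.
  by apply: (@cvgr_distC_le _ _ _ (nbhs (P z0)) _ id) => //; rewrite divr_gt0.
split.
- have [|v0 Gv0] := sP (P z0); first by rewrite subrr normr0 divr_ge0// ltW.
  have := GL _ 0 v0; rewrite normr0 => /(_ (ltW d0)); rewrite Gv0 G0 subrr normr0 mulr0 subr0.
  by rewrite normr_le0 => /eqP->; rewrite mul0mx addr0.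
- exists (K * 2); first by rewrite mulr_gt0.
  exists [set y | `|y - P z0| <= d / 2] => // y y' /sP[yd yG] /sP[y'd y'G].
  rewrite opprD addrACA subrr add0r -mulmxBl (le_trans (SK _))// -mulrA ler_pM2l//.
  by rewrite (le_trans (GL _ _ yd y'd))// yG y'G.
- by apply: filterS (nP) => y /sP[].
Qed.

(** Along a local Lipschitz section [s] of [P], [Y y] is [X (s y) *m 'J P (s y)], and ['J P] is
    locally Lipschitz because [P] is C^2. *)
Lemma lipschitz_near_descend m n (D : set 'rV[R]_m) (P : 'rV[R]_m -> 'rV[R]_n)
    (X : 'rV[R]_m -> 'rV[R]_m) (Y : 'rV[R]_n -> 'rV[R]_n) z0 :
  open D -> D z0 -> smooth_on D P -> row_full ('J P z0) ->
  lipschitz_near X z0 -> (\forall z \near z0, X z *m 'J P z = Y (P z)) ->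
  lipschitz_near Y (P z0).
Proof.
move=> oD Dz0 CP Pfull Xl XY.
have [s [sz0 sl Ps]] := lipschitz_section oD Dz0 (CP 1) Pfull.
have Jl := C2_lipschitz_near_jacobian oD Dz0 (CP 2).
have XJl := lipschitz_near_mulmx Xl Jl.
rewrite -sz0 in XJl; have XJsl := lipschitz_near_comp sl XJl.
apply: near_lipschitz_eq XJsl.
have : \forall y \near P z0, X (s y) *m 'J P (s y) = Y (P (s y)).
  have sc : s @ P z0 --> z0 by rewrite -[X in _ --> X]sz0; exact: lipschitz_near_continuous.
  exact: sc XY.
by move=> XYs; apply: filterS2 (Ps) (XYs) => y Py XYy; rewrite /= XYy Py.
Qed.

End LipschitzSection.

(** * Maps and vector fields in charts *)

Section Charts.
Context {R : realType}.

Lemma cinvK n T (c : chart n T) (z : 'rV[R]_n) : cimg c z -> cmap c (cinv c z) = z.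
Proof. by move=> [x cx <-]; rewrite cmapK. Qed.

Lemma cinv_dom n T (c : chart n T) (z : 'rV[R]_n) : cimg c z -> cdom c (cinv c z).
Proof. by move=> [x cx <-]; rewrite cmapK. Qed.

Lemma near_cimg n T (c : @chart R n T) x : cdom c x ->
  \forall z \near cmap c x, cimg c z.
Proof. by move=> cx; apply: open_nbhs_nbhs; split; [exact: cimg_open|exists x]. Qed.

Lemma near_cinv n T (c : @chart R n T) x (N : set T) : cdom c x -> nbhs x N ->
  \forall z \near cmap c x, N (cinv c z).
Proof.
move=> cx Nx; apply: (@cinv_continuous _ _ _ c (cmap c x)); first by exists x.
by rewrite cmapK.
Qed.

Lemma near_cdom n T (c : @chart R n T) x : cdom c x -> nbhs x (cdom c).
Proof. by move=> cx; apply: open_nbhs_nbhs; split=> //; exact: cdom_open. Qed.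

Definition rep_dom m n S T (c : @chart R m S) (c' : @chart R n T) (f : S -> T) :=
  cmap c @` (cdom c `&` f @^-1` cdom c').

(** The coordinate expression of [f]. Its Jacobian is [tmap] in the preferred charts, and
    [coord_change] when [f] is the identity. *)
Definition rep m n S T (c : @chart R m S) (c' : @chart R n T) (f : S -> T) :=
  cmap c' \o f \o cinv c.

Lemma rep_cmap m n S T (c : @chart R m S) (c' : @chart R n T) (f : S -> T) x :
  cdom c x -> rep c c' f (cmap c x) = cmap c' (f x).
Proof. by move=> cx; rewrite /rep/= cmapK. Qed.

Lemma rep_dom_open m n S T (c : @chart R m S) (c' : @chart R n T) (f : S -> T) :
  continuous f -> open (rep_dom c c' f).
Proof.
move=> cf; rewrite openE => _ [x [cx c'x] <-].
have : nbhs x (cdom c `&` f @^-1` cdom c').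
  by apply: filterI; [exact: near_cdom|apply: cf; exact: near_cdom].
move=> /(near_cinv cx); apply: filterS2 (near_cimg cx) => z cz [cz' fz].
by exists (cinv c z) => //; exact: cinvK.
Qed.

Section SmoothMaps.
Context (m n : nat) (S T : topologicalType) (mS : @manifold R m S)
  (mT : @manifold R n T).
Variable f : S -> T.
Hypothesis fsmooth : smooth_map mS mT f.

Lemma rep_smooth c c' : atlas mS c -> atlas mT c' ->
  smooth_on (rep_dom c c' f) (rep c c' f).
Proof. exact: fsmooth.2. Qed.

Lemma rep_differentiable c c' x : atlas mS c -> atlas mT c' ->
  cdom c x -> cdom c' (f x) -> differentiable (rep c c' f) (cmap c x).
Proof. by move=> ac ac' cx c'x; apply: (rep_smooth ac ac' 1).1; exists x. Qed.

End SmoothMaps.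

(** Makes changes of chart a special case of coordinate expressions of maps. *)
Lemma smooth_map_id n T (mT : @manifold R n T) : smooth_map mT mT id.
Proof. by split=> [x //|c c' ac ac']; exact: (chart_compat ac ac'). Qed.

(** The intermediate chart cancels only near the point, where [f] stays in [cdom b]; hence the
    appeal to locality of the Jacobian. *)
Lemma jacobian_rep_comp l m n S T W (mS : @manifold R l S) (mT : @manifold R m T)
    (mW : @manifold R n W) (f : S -> T) (g : T -> W) a b c x :
  smooth_map mS mT f -> smooth_map mT mW g ->
  atlas mS a -> atlas mT b -> atlas mW c ->
  cdom a x -> cdom b (f x) -> cdom c (g (f x)) ->
  'J (rep a c (g \o f)) (cmap a x) =
  'J (rep a b f) (cmap a x) *m 'J (rep b c g) (cmap b (f x)).
Proof.
move=> fs gs aa ab ac ax bx cx.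
have df := rep_differentiable fs aa ab ax bx.
have dg := rep_differentiable gs ab ac bx cx.
rewrite -(rep_cmap _ f ax) in dg *.
rewrite -(jacobian_comp df dg); apply/esym/near_eq_jacobian.
  have : nbhs x (f @^-1` cdom b) by apply: fs.1; exact: near_cdom.
  by move=> /(near_cinv ax); apply: filterS => z bz; rewrite /rep/= cmapK.
exact: differentiable_comp.
Qed.

Lemma vf_in_cmap n T (mT : @manifold R n T) (V : vector_field mT) c x :
  cdom c x -> vf_in V c (cmap c x) = V x *m coord_change (chart_at mT x) c x.
Proof. by move=> cx; rewrite /vf_in cmapK. Qed.

(** [related] speaks of the preferred charts. Changing chart before or after applying [f] factors
    the same Jacobian, from the preferred chart at [x] to [c']. *)
Lemma related_rep m n S T (mS : @manifold R m S) (mT : @manifold R n T)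
    (f : S -> T) (X : vector_field mS) (Y : vector_field mT) c c' x :
  smooth_map mS mT f -> related f X Y ->
  atlas mS c -> atlas mT c' -> cdom c x -> cdom c' (f x) ->
  vf_in X c (cmap c x) *m 'J (rep c c' f) (cmap c x) = vf_in Y c' (cmap c' (f x)).
Proof.
move=> fs XY ac ac' cx c'x; rewrite !vf_in_cmap// -XY.
have sid := smooth_map_id; have aS := chart_at_atlas mS x.
have aT := chart_at_atlas mT (f x).
have dS := chart_at_dom mS x; have dT := chart_at_dom mT (f x).
have := jacobian_rep_comp (sid _ _ mS) fs aS ac ac' dS cx c'x.
rewrite (jacobian_rep_comp fs (sid _ _ mT) aS aT ac' dS dT c'x).
by rewrite -!mulmxA => ->.
Qed.

End Charts.

(** * Lipschitz vector fields under immersions and submersions *)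

Section LipschitzFields.
Context {R : realType}.

(** Tested only in the preferred chart at each point, which is where local uniqueness is proved. *)
Definition lipschitz_field n T (mT : @manifold R n T) (V : vector_field mT) :=
  forall x, lipschitz_near (vf_in V (chart_at mT x)) (cmap (chart_at mT x) x).

Lemma near_related_rep m n S T (mS : @manifold R m S) (mT : @manifold R n T)
    (f : S -> T) (X : vector_field mS) (Y : vector_field mT) c c' x :
  smooth_map mS mT f -> related f X Y ->
  atlas mS c -> atlas mT c' -> cdom c x -> cdom c' (f x) ->
  \forall z \near cmap c x,
    vf_in X c z *m 'J (rep c c' f) z = vf_in Y c' (rep c c' f z).
Proof.
move=> fs XY ac ac' cx c'x.
have /(near_cinv cx) : nbhs x (f @^-1` cdom c') by apply: fs.1; exact: near_cdom.
move=> nf; apply: filterS2 (near_cimg cx) (nf) => z cz fz.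
have := related_rep fs XY ac ac' (cinv_dom cz) fz.
by rewrite (cinvK cz).
Qed.

(** In charts [X] solves a linear system whose matrix, the Jacobian of [f], is row free and
    Lipschitz and whose right-hand side is [Y] along [f]; [lipschitz_near_solve] applies. *)
Lemma lipschitz_field_immersion m n S T (mS : @manifold R m S)
    (mT : @manifold R n T) (f : S -> T) (X : vector_field mS)
    (Y : vector_field mT) :
  immersion mS mT f -> Ck_field 1 Y -> related f X Y -> lipschitz_field X.
Proof.
move=> [fs ffree] CY XY x; pose c := chart_at mS x; pose c' := chart_at mT (f x).
have [ac ac'] := (chart_at_atlas mS x, chart_at_atlas mT (f x)).
have [dc dc'] := (chart_at_dom mS x, chart_at_dom mT (f x)).
have oD := @rep_dom_open _ _ _ _ _ c c' f fs.1.
have Dx : rep_dom c c' f (cmap c x) by exists x.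
have fC := rep_smooth fs ac ac'.
have oc' : open (cimg c') by exact: cimg_open.
have c'fx : cimg c' (cmap c' (f x)) by exists (f x).
apply: (lipschitz_near_solve (B := fun z => 'J (rep c c' f) z)
  (Y := vf_in Y c' \o rep c c' f)).
- exact: C2_lipschitz_near_jacobian oD Dx (fC 2).
- apply: lipschitz_near_comp; first exact: C1_lipschitz_near oD Dx (fC 1).
  by rewrite rep_cmap//; exact: C1_lipschitz_near oc' c'fx (CY _ ac').
- exact: ffree.
- exact: near_related_rep.
Qed.

(** Surjectivity gives a point above each [y], around which [lipschitz_near_descend] applies in
    charts. *)
Lemma lipschitz_field_submersion m n S T (mS : @manifold R m S)
    (mT : @manifold R n T) (f : S -> T) (X : vector_field mS)
    (Y : vector_field mT) :
  submersion mS mT f -> (forall y, exists x, f x = y) -> lipschitz_field X ->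
  related f X Y -> lipschitz_field Y.
Proof.
move=> [fs ffull] fsurj Xl XY y; have [x <-] := fsurj y.
pose c := chart_at mS x; pose c' := chart_at mT (f x).
have [ac ac'] := (chart_at_atlas mS x, chart_at_atlas mT (f x)).
have [dc dc'] := (chart_at_dom mS x, chart_at_dom mT (f x)).
have Dx : rep_dom c c' f (cmap c x) by exists x.
rewrite -(rep_cmap c' f dc).
apply: (lipschitz_near_descend (@rep_dom_open _ _ _ _ _ c c' f fs.1) Dx
  (rep_smooth fs ac ac') _ (Xl x)); first exact: ffull.
exact: near_related_rep.
Qed.

End LipschitzFields.

(** * Integral curves *)

Section Velocity.
Context {R : realType}.

(** Working within [A] covers the one-sided derivative at time 0. The error splits into [v - q s]
    times the Jacobian and the rescaled remainder of [F], each at most [e / 2]. *)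
Lemma velocity_chain m n (A : set R) (a : R -> 'rV[R]_m)
    (F : 'rV[R]_m -> 'rV[R]_n) t (v : 'rV[R]_m) :
  differentiable F (a t) ->
  (s - t)^-1 *: (a s - a t) @[s --> within A t^'] --> v ->
  (s - t)^-1 *: (F (a s) - F (a t)) @[s --> within A t^'] --> v *m 'J F (a t).
Proof.
move=> dF av; set J := 'J F (a t).
pose q s := (s - t)^-1 *: (a s - a t).
have st : \forall s \near within A t^', s != t.
  exact: (@cvg_within _ _ _ A _ (nbhs_dnbhs_neq t)).
have st0 : s - t @[s --> within A t^'] --> 0.
  rewrite -(subrr t); apply: cvgB; last exact: cvg_cst.
  by move=> P /nbhs_dnbhs Pt; exact: (@cvg_within _ _ _ A _ Pt).
have aE : \forall s \near within A t^', (s - t) *: q s = a s - a t.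
  apply: filterS st => s st; rewrite /q scalerA mulfV ?scale1r// subr_eq0//.
(* A convergent quotient [q s] multiplied by [s - t] tends to 0, so the expansion of [F] at [a t]
   can be evaluated along the curve. *)
have ac : a s - a t @[s --> within A t^'] --> (0 : 'rV[R]_m).
  apply: cvg_trans; first exact: near_eq_cvg aE.
  by rewrite -(scale0r v); exact: cvgZ.
apply/cvgrPdist_le => e e0.
have qb : \forall s \near within A t^', `|q s| <= `|v| + 1.
  have /cvgrPdist_le/(_ 1 ltr01) := av; apply: filterS => s qs.
  rewrite -[q s](subKr v) (le_trans (ler_normB _ _))// lerD2l//.
(* This constant is paired with the bound on [q s], the next one with the norm of [J]; adding 1
   makes the denominators positive. *)
have e1 : 0 < e / 2 / (`|v| + 1) by rewrite !divr_gt0// ltr_wpDl.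
have e2 : 0 < e / 2 / (m%:R * `|J| + 1).
  by rewrite !divr_gt0// ltr_wpDl// mulr_ge0.
have qv : \forall s \near within A t^', `|v - q s| <= e / 2 / (m%:R * `|J| + 1).
  by have /cvgrPdist_le/(_ _ e2) := av.
have Fo : \forall s \near within A t^',
    `|F (a s) - F (a t) - (a s - a t) *m J| <= e / 2 / (`|v| + 1) * `|a s - a t|.
  have /diff_locallyP[_ /eqaddoP/(_ _ e1)] := dF => H.
  have H1 : \forall s \near within A t^',
      `|F (a s - a t + a t) - (F (a t) + 'd F (a t) (a s - a t))| <=
      e / 2 / (`|v| + 1) * `|a s - a t| by exact: (ac _ H).
  by apply: filterS H1 => s; rewrite subrK diff_jacobian opprD addrA.
have HH : \forall s \near within A t^', [/\ s != t, `|q s| <= `|v| + 1,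
    `|v - q s| <= e / 2 / (m%:R * `|J| + 1) &
    `|F (a s) - F (a t) - (a s - a t) *m J| <= e / 2 / (`|v| + 1) * `|a s - a t|].
  by near=> s; split; near: s.
apply: filterS HH => s [sNt qs vqs Fs].
have -> : v *m J - (s - t)^-1 *: (F (a s) - F (a t)) = (v - q s) *m J -
    (s - t)^-1 *: (F (a s) - F (a t) - (a s - a t) *m J).
  by rewrite mulmxBl [in RHS]scalerBr scalemxAl -/(q s) opprB addrA subrK.
have h1 : `|(v - q s) *m J| <= e / 2.
  rewrite (le_trans (ler_normM _ _))// mulrAC.
  rewrite (le_trans (ler_wpM2l _ vqs))// ?mulr_ge0// mulrA.
  rewrite ler_pdivrMr ?ltr_wpDl ?mulr_ge0// mulrC ler_wpM2l ?lerDl//.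
  by rewrite divr_ge0// ltW.
have h2 : `|(s - t)^-1 *: (F (a s) - F (a t) - (a s - a t) *m J)| <= e / 2.
  rewrite normrZ (le_trans (ler_wpM2l _ Fs))// mulrCA -normrZ.
  rewrite (le_trans (ler_wpM2l (ltW e1) qs))// divfK// gt_eqF// ltr_wpDl//.
rewrite (le_trans (ler_normB _ _))//; lra.
Unshelve. all: by end_near. Qed.

End Velocity.

(** * Integral curves in arbitrary charts and their images under maps *)

Section IntegralCurves.
Context {R : realType}.

(** The limit required by [integral_curve], in an arbitrary chart instead of the preferred one. *)
Definition has_velocity n T (c : @chart R n T) (u : R -> T) (t : R)
    (v : 'rV[R]_n) :=
  (s - t)^-1 *: (cmap c (u s) - cmap c (u t))
    @[s --> within [set s | 0 <= s] t^'] --> v.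

Lemma curve_near (T : topologicalType) (u : R -> T) (t : R) (N : set T) :
  {within [set s : R | 0 <= s], continuous u} -> 0 <= t -> nbhs (u t) N ->
  \forall s \near t, 0 <= s -> N (u s).
Proof.
move=> cu t0 Nu; have := cu t _ Nu.
by rewrite /nbhs/= -(nbhs_subspace_in (A := [set s : R | 0 <= s])).
Qed.

Lemma curve_dnear (T : topologicalType) (u : R -> T) (t : R) (N : set T) :
  {within [set s : R | 0 <= s], continuous u} -> 0 <= t -> nbhs (u t) N ->
  \forall s \near within [set s | 0 <= s] t^', N (u s).
Proof.
move=> cu t0 Nu; have /nbhs_dnbhs := curve_near cu t0 Nu.
by apply: filterS => s.
Qed.

(** Used with the identity to change charts, and with a general [f] to push integral curves
    forward. *)
Lemma has_velocity_rep m n S T (mS : @manifold R m S) (mT : @manifold R n T)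
    (f : S -> T) c c' (u : R -> S) (t : R) v :
  smooth_map mS mT f -> {within [set s : R | 0 <= s], continuous u} -> 0 <= t ->
  atlas mS c -> atlas mT c' -> cdom c (u t) -> cdom c' (f (u t)) ->
  has_velocity c u t v ->
  has_velocity c' (f \o u) t (v *m 'J (rep c c' f) (cmap c (u t))).
Proof.
move=> fs cu t0 ac ac' cut c'fut uv.
have df := rep_differentiable fs ac ac' cut c'fut.
have := velocity_chain (a := cmap c \o u) df uv.
apply: cvg_trans; apply: near_eq_cvg.
have : \forall s \near within [set s | 0 <= s] t^', cdom c (u s).
  by apply: curve_dnear => //; exact: near_cdom.
by apply: filterS => s us; rewrite /= !rep_cmap.
Qed.

Section OneManifold.
Context (n : nat) (T : topologicalType) (mT : @manifold R n T).
Variable V : vector_field mT.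

Lemma integral_curve_chart (u : R -> T) (t : R) c :
  integral_curve V u -> 0 <= t -> atlas mT c -> cdom c (u t) ->
  has_velocity c u t (vf_in V c (cmap c (u t))).
Proof.
move=> [cu du] t0 ac cut; rewrite vf_in_cmap//.
exact: (has_velocity_rep (smooth_map_id mT) cu t0 (chart_at_atlas _ _) ac
  (chart_at_dom _ _) cut (du t t0)).
Qed.

End OneManifold.

Lemma integral_curve_comp m n S T (mS : @manifold R m S) (mT : @manifold R n T)
    (f : S -> T) (X : vector_field mS) (Y : vector_field mT) (u : R -> S) :
  smooth_map mS mT f -> related f X Y -> integral_curve X u ->
  integral_curve Y (f \o u).
Proof.
move=> fs XY [cu du]; split.
  by move=> t N /fs.1 Nf; exact: (cu t _ Nf).
move=> t t0 /=; rewrite -XY.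
exact: (has_velocity_rep fs cu t0 (chart_at_atlas _ _) (chart_at_atlas _ _)
  (chart_at_dom _ _) (chart_at_dom _ _) (du t t0)).
Qed.

(** At a positive time the constraint [0 <= s] holds throughout a neighbourhood, so the restricted
    limit is an ordinary derivative. *)
Lemma has_velocity_is_derive n T (c : @chart R n T) (u : R -> T) t v j :
  0 < t -> has_velocity c u t v ->
  is_derive t (1 : R) (fun s => cmap c (u s) 0 j) (v 0 j).
Proof.
move=> t0 uv.
have st : h%:A + t @[h --> 0^'] `=>` within [set s | 0 <= s] t^'.
  move=> P; rewrite /within/= => /nbhs_ballP[e /= e0 eP].
  apply/nbhs_ballP; exists (Num.min e t); first by rewrite /= lt_min e0.
  move=> h; rewrite -ball_normE/= sub0r normrN lt_min => /andP[he ht] hN0.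
  apply: eP.
  - by rewrite -ball_normE/= [_%:A]mulr1 opprD addrCA subrr addr0 normrN.
  - by rewrite [_%:A]mulr1 -subr_eq0 addrK.
  - by rewrite /= [_%:A]mulr1; move: ht; rewrite ltr_norml => /andP[]; lra.
have : h^-1 *: (cmap c (u (h%:A + t)) 0 j - cmap c (u t) 0 j) @[h --> 0^'] --> v 0 j.
  have suv : (fun s => (s - t)^-1 *: (cmap c (u s) - cmap c (u t))) \o
      (fun h : R => h%:A + t) @ 0^' --> v by exact: cvg_comp st uv.
  have suvj : (fun M : 'rV[R]_n => M 0 j) \o ((fun s => (s - t)^-1 *:
      (cmap c (u s) - cmap c (u t))) \o (fun h : R => h%:A + t)) @ 0^' --> v 0 j.
    by apply: cvg_comp suv _; exact: coord_continuous.
  apply: cvg_trans suvj; apply: near_eq_cvg; apply: nearW => h /=.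
  by rewrite [_%:A]mulr1 addrK !mxE.
by move=> uvl; split; [apply/cvg_ex; exists (v 0 j)|exact: cvg_lim uvl].
Qed.

End IntegralCurves.

(** * Uniqueness of integral curves of a Lipschitz field *)

Section Uniqueness.
Context {R : realType} (n : nat) (T : topologicalType) (mT : @manifold R n T).
Variable V : vector_field mT.
Hypothesis Vlip : lipschitz_field V.

(* On a short interval the maximum [m] of [|u - w|] satisfies [m <= m / 2]. *)
Lemma integral_curve_unique_near (u w : R -> T) (t0 : R) :
  integral_curve V u -> integral_curve V w -> 0 <= t0 -> u t0 = w t0 ->
  exists2 d : R, 0 < d & forall t, t0 <= t <= t0 + d -> u t = w t.
Proof.
move=> uV wV t0_ge0 uw.
pose c := chart_at mT (u t0).
have ac : atlas mT c := chart_at_atlas _ _.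
have cu : cdom c (u t0) := chart_at_dom _ _.
have [L L0 [N Nu NP]] := Vlip (u t0).
have ND : nbhs (u t0) (cdom c `&` cmap c @^-1` N).
  by apply: filterI; [exact: near_cdom|exact: cmap_continuous].
have unear := curve_near uV.1 t0_ge0 ND.
have wnear : \forall s \near t0, 0 <= s -> (cdom c `&` cmap c @^-1` N) (w s).
  by apply: (curve_near wV.1 t0_ge0); rewrite -uw.
have : \forall s \near t0, 0 <= s -> (cdom c `&` cmap c @^-1` N) (u s) /\
    (cdom c `&` cmap c @^-1` N) (w s).
  by apply: filterS2 unear wnear => s us ws s0; split; [exact: us|exact: ws].
move=> /nbhs_ballP[r /= r0 rP].
(* The first bound keeps both curves in the chart and in [N]; the second gives the factor 1/2. *)
pose d := Num.min (r / 2) (2 * L)^-1.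
have d0 : 0 < d by rewrite lt_min divr_gt0//= invr_gt0 mulr_gt0.
have dr : d < r by rewrite gt_min; apply/orP; left; lra.
have dL : d * L <= 2^-1.
  rewrite -ler_pdivlMr// -invfM ge_min lexx orbT//.
exists d => // t tt0.
have tP s : t0 <= s <= t0 + d -> [/\ 0 <= s, cdom c (u s), cdom c (w s),
    N (cmap c (u s)) & N (cmap c (w s))].
  move=> /andP[s1 s2]; have s0 : 0 <= s by exact: le_trans s1.
  have [|//|[? ?] [? ?]//] := rP s; rewrite -ball_normE/= distrC ger0_norm; lra.
pose e s := cmap c (u s) - cmap c (w s).
have eC : {within `[t0, t0 + d], continuous e}.
  have sub : `[t0, t0 + d] `<=` [set s | 0 <= s].
    by move=> s; rewrite /= in_itv/= => /tP[].
  have uc := continuous_subspaceW sub uV.1; have wc := continuous_subspaceW sub wV.1.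
  rewrite continuous_subspace_in => s; rewrite inE/= in_itv/= => /tP[_ us ws _ _].
  apply: cvgB.
  - by apply: cvg_comp (uc s) _; exact: cmap_continuous.
  - by apply: cvg_comp (wc s) _; exact: cmap_continuous.
have ec : {within `[t0, t0 + d], continuous (fun s => `|e s|)}.
  by move=> s; exact: cvg_norm (eC s).
have [|m mI mM] := @EVT_max R (fun s => `|e s|) t0 (t0 + d) _ ec.
  by rewrite lerDl ltW.
rewrite in_itv/= in mI.
have em : `|e m| <= 2^-1 * `|e m|.
  apply: mx_norm_ler => [|i j]; first by rewrite mulr_ge0.
  rewrite (ord1 i).
  have /andP[m1 m2] := mI.
  (* As [e t0 = 0], each coordinate of [e m] is [m - t0], at most [d], times a difference of field
     values, at most [L] times the maximum of the norm of [e]. *)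
  have [s||s sI] := @MVT_segment R (fun s => e s 0 j) (fun s =>
    (vf_in V c (cmap c (u s)) - vf_in V c (cmap c (w s))) 0 j) t0 m m1.
  - rewrite in_itv/= => /andP[s1 s2].
    have sI : t0 <= s <= t0 + d by rewrite (ltW s1) (le_trans (ltW s2)).
    have [s0 us ws _ _] := tP s sI.
    have sgt0 : 0 < s by exact: le_lt_trans s1.
    have du := has_velocity_is_derive j sgt0 (integral_curve_chart uV s0 ac us).
    have dw := has_velocity_is_derive j sgt0 (integral_curve_chart wV s0 ac ws).
    have -> : (fun s => e s 0 j) =
        (fun s => cmap c (u s) 0 j) - (fun s => cmap c (w s) 0 j).
      by apply/funext => x; rewrite /e mxE [X in _ + X]mxE.
    have subE (a b : 'rV[R]_n) : (a - b) 0 j = a 0 j - b 0 j by rewrite !mxE.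
    exact: is_derive_eq (is_deriveB du dw) (esym (subE _ _)).
  - have sub : `[t0, m] `<=` `[t0, t0 + d].
      by move=> s; rewrite /= !in_itv/= => /andP[-> /le_trans->].
    have eM := continuous_subspaceW sub eC; move=> s.
    apply: (@cvg_comp _ _ _ e (fun M : 'rV[R]_n => M 0 j) _ _ _ (eM s)).
    exact: coord_continuous.
  rewrite in_itv/= in sI => emE.
  have sI' : t0 <= s <= t0 + d.
    by case/andP: sI => -> /le_trans->.
  have [_ _ _ Nus Nws] := tP s sI'.
  have Vem : `|(vf_in V c (cmap c (u s)) - vf_in V c (cmap c (w s))) 0 j| <= L * `|e m|.
    rewrite (le_trans (ler_norm_entry _ _ _))// (le_trans (NP _ _ Nus Nws))//.
    by rewrite ler_pM2l// mM// in_itv.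
  have et0 : e t0 0 j = 0 by rewrite /e uw subrr mxE.
  rewrite et0 subr0 in emE; rewrite emE normrM [`|m - t0|]ger0_norm ?subr_ge0//.
  have md : m - t0 <= d by rewrite lerBlDl.
  rewrite (le_trans (ler_pM _ _ Vem md))// ?subr_ge0// mulrC mulrA.
  by rewrite ler_wpM2r.
have e0 : `|e m| = 0 by apply/eqP; rewrite eq_le normr_ge0 andbT; lra.
have et : e t = 0.
  by apply/eqP; rewrite -normr_eq0 eq_le normr_ge0 andbT -e0 mM// in_itv.
have [_ ut wt _ _] := tP t tt0.
by rewrite -(cmapK ut) -(cmapK wt); move/eqP: et; rewrite subr_eq0 => /eqP->.
Qed.

(** Let [t] be the supremum of the times up to which the curves agree. They still agree at [t], and
    local uniqueness carries them past it, a contradiction. *)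
Lemma integral_curve_unique (u w : R -> T) :
  integral_curve V u -> integral_curve V w -> u 0 = w 0 ->
  forall t, 0 <= t -> u t = w t.
Proof.
move=> uV wV uw0; pose E : set R := [set t | 0 <= t /\
  forall s, 0 <= s <= t -> u s = w s].
have E0 : E 0.
  by split=> // s /andP[s0 s1]; have -> : s = 0 by apply/eqP; rewrite eq_le s0 s1.
move=> t1 t1_ge0; apply: contrapT => uwt1.
have Eub : ubound E t1.
  move=> t [t0 tE]; rewrite leNgt; apply/negP => tt1.
  by apply: uwt1; apply: tE; rewrite t1_ge0 ltW.
have supE : has_sup E by split; [exists 0|exists t1].
pose t := sup E.
have t_ge0 : 0 <= t by apply: sup_upper_bound supE 0 E0.
have below s : 0 <= s < t -> u s = w s.
  move=> /andP[s0 st].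
  have [t' [t'0 t'E] st'] : exists2 t', E t' & s < t'.
    have ts0 : 0 < t - s by rewrite subr_gt0.
    by have [t' Et'] := sup_adherent ts0 supE; rewrite subKr; exists t'.
  by apply: t'E; rewrite s0 ltW.
have uwt : u t = w t.
  have [t0|t0] := eqVneq t 0; first by rewrite t0.
  have tgt0 : 0 < t by rewrite lt_neqAle eq_sym t0.
  (* Any neighbourhoods of [u t] and [w t] meet, since both contain the common value of the curves
     at times just before [t]. *)
  apply: (manifold_hausdorff mT) => A B uA wB.
  have nA := curve_near uV.1 t_ge0 uA; have nB := curve_near wV.1 t_ge0 wB.
  have : \forall s \near t, 0 <= s -> A (u s) /\ B (w s).
    by apply: filterS2 nA nB => s us ws s0; split; [exact: us|exact: ws].
  move=> /nbhs_ballP[r /= r0 rP].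
  (* The minimum makes [s] nonnegative, strictly below [t], and within [r] of it. *)
  pose s := t - Num.min t (r / 2).
  have m0 : 0 < Num.min t (r / 2) by rewrite lt_min tgt0 divr_gt0.
  have [m1 m2] : Num.min t (r / 2) <= t /\ Num.min t (r / 2) < r.
    by split; [rewrite ge_min lexx|rewrite gt_min; apply/orP; right; lra].
  have s0 : 0 <= s by rewrite subr_ge0.
  have [|//|As Bs] := rP s.
    by rewrite -ball_normE/= /s opprB addrC subrK gtr0_norm.
  exists (u s); split=> //.
  by rewrite below; [|rewrite s0 /s ltrBlDr ltrDl].
have [d d0 dE] := integral_curve_unique_near uV wV t_ge0 uwt.
have : E (t + d).
  split=> [|s /andP[s0 sd]]; first by rewrite addr_ge0// ltW.
  by have [st|ts] := ltP s t; [apply: below; rewrite s0|apply: dE; rewrite ts].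
move=> /(sup_upper_bound supE); rewrite -/t; lra.
Qed.

End Uniqueness.

(** * Semiconjugacy of the two semiflows and the projected attractor *)

Theorem proposition6p1 (R : realType) (n k : nat)
  (U : topologicalType) (mU : @manifold R n U)
  (g : tensor02 mU) (Phi : U -> R)
  (M : metricType R) (mM : @manifold R n.-1 M) (iota : M -> U)
  (V : vector_field mU) (VM : vector_field mM)
  (Q : topologicalType) (mQ : @manifold R (n.-1 - k) Q) (p : M -> Q)
  (VQ : vector_field mQ)
  (phi : R -> M -> M) (psi : R -> Q -> Q) (A : set M) :
  (* the Lorentzian manifold *)
  smooth_tensor g -> symmetric_tensor g -> lorentzian g ->
  (* the constraint hypersurface M = Phi^-1(0), with inclusion iota *)
  smooth_fun mU Phi ->
  (forall x, Phi x = 0 -> exists v, dfun mU Phi x v != 0) ->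
  immersion mM mU iota -> topological_embedding iota ->
  range iota = [set x | Phi x = 0] ->
  (* the induced form has constant corank k >= 1 *)
  (1 <= k)%N ->
  (forall x, (n.-1 - \rank (pullback mM iota g x))%N = k) ->
  (* the constraint-preserving vector field, and its restriction VM to M *)
  Ck_field 2 V ->
  (forall x, Phi x = 0 -> dfun mU Phi x (V x) = 0) ->
  related iota VM V ->
  (* the null foliation and its leaf space *)
  involutive_distribution (null_distribution mM iota g) ->
  (forall L, leaf (null_distribution mM iota g) L ->
    compact_embedded (null_distribution mM iota g) L) ->
  is_leaf_space (null_distribution mM iota g) mQ p ->
  (* projectability, the projected field and the reduced semiflow *)
  projectable (null_distribution mM iota g) VM ->
  related p VM VQ ->
  generates VQ psi ->
  (* dynamics on M *)
  generates VM phi ->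
  asymptotically_compact phi ->
  (exists B, bounded_absorbing phi B) ->
  global_attractor phi A ->
  compact (p @` A) /\ invariant_set psi (p @` A).
Proof.
move=> _ _ _ _ _ iota_imm _ _ _ _ V2 _ iotaV _ _ [p_surj _ _ p_sub] _ pV.
move=> [[psi0 _ _] psi_curve] [[phi0 _ _] phi_curve] _ _ [A_compact A_inv _].
(* What has to be checked is the continuity of the directional derivatives, which follows from their
   differentiability. *)
have V1 : Ck_field 1 V.
  by move=> c ac; have [dV CV] := V2 c ac; split=> // v z cz;
     apply: differentiable_continuous; exact: (CV v).1.
have VM_lip := lipschitz_field_immersion iota_imm V1 iotaV.
have VQ_lip := lipschitz_field_submersion p_sub p_surj VM_lip pV.
have p_phi t x : 0 <= t -> p (phi t x) = psi t (p x).
  have px := integral_curve_comp p_sub.1 pV (phi_curve x).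
  have px0 : (p \o phi^~ x) 0 = psi 0 (p x) by rewrite /= phi0 psi0.
  exact: (integral_curve_unique VQ_lip px (psi_curve (p x)) px0 (t := t)).
split.
  by apply: continuous_compact A_compact; apply: continuous_subspaceT => x; exact: p_sub.1.1.
(* Replacing the right-hand [A] by its image under [phi t] makes both sides images of [A], under
   [psi t \o p] and [p \o phi t]. *)
move=> t t0; rewrite -[in RHS](A_inv t t0) !image_comp.
by apply: eq_imagel => x _; rewrite /= p_phi.
Qed.
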